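(* Let $\mathcal{C}$ be a $(\mathrm{fam},\Sigma)$-category. For every object $a$ of $\mathcal{C}$ and every $\lambda\in\mathrm{fHom}(a)$ let $$\mathcal{D}_a\lambda:=\Big\{\phi\in\mathrm{Hom}\Big(a,\sum_a\lambda\Big)\ \Big|\ \mathrm{pr}_1^{a,\lambda}\circ\phi=1_a\Big\}$$ be the set of dependent objects of $\lambda$. With the dependent structure $\mathrm{dHom}(a,\lambda):=\mathcal{D}_a\lambda$ the $(\mathrm{fam},\Sigma)$-category $\mathcal{C}$ becomes a dep-category.
   Context: A category $\mathcal{C}$ (with objects $C_0$ and arrows $C_1$) is a fam-category (category with family-arrows) if: (a) for every object $a$ there is a collection $\mathrm{fHom}(a)$ of ''family-arrows''; (b) for all objects $a,b$ there is a composition-operation $\mathrm{fHom}(a)\times \mathrm{Hom}(b,a)\to \mathrm{fHom}(b)$, $(\lambda,f)\mapsto \lambda\circ f$, with $\lambda\circ 1_a=\lambda$ and $\lambda\circ(f\circ g)=(\lambda\circ f)\circ g$ for all $\lambda\in\mathrm{fHom}(a)$, $f\in\mathrm{Hom}(b,a)$, $g\in\mathrm{Hom}(c,b)$. A $(\mathrm{fam},\Sigma)$-category (fam-category with Sigma-objects) is a fam-category $\mathcal{C}$ equipped with: for every object $a$ and $\lambda\in\mathrm{fHom}(a)$, an object $\sum_a\lambda$ (the Sigma-object of $\lambda$) and an arrow $\mathrm{pr}_1^{a,\lambda}\colon\sum_a\lambda\to a$ (the first-projection-arrow); and for every $f\in\mathrm{Hom}(b,a)$ and $\lambda\in\mathrm{fHom}(a)$,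 an arrow $\Sigma_\lambda f\colon\sum_b(\lambda\circ f)\to\sum_a\lambda$ such that the square $\mathrm{pr}_1^{a,\lambda}\circ\Sigma_\lambda f=f\circ\mathrm{pr}_1^{b,\lambda\circ f}$ is a pullback (of $\mathrm{pr}_1^{a,\lambda}$ along $f$), and the following strictness conditions hold: $\Sigma_\lambda 1_a=1_{\sum_a\lambda}$, and $\Sigma_\lambda(f\circ g)=(\Sigma_\lambda f)\circ\Sigma_{(\lambda\circ f)}g$ for all $f\in\mathrm{Hom}(b,a)$, $g\in\mathrm{Hom}(c,b)$. A dep-category (category with dependent arrows) is a fam-category $\mathcal{C}$ such that: for every object $a$ and $\lambda\in\mathrm{fHom}(a)$ there is a collection $\mathrm{dHom}(a,\lambda)$ of ''dependent arrows'' over $(a,\lambda)$; and for every $\Phi\in\mathrm{dHom}(a,\lambda)$ and $f\in\mathrm{Hom}(b,a)$ there is a dependent arrow $\Phi(f)\in\mathrm{dHom}(b,\lambda\circ f)$, called the application of $\Phi$ to $f$, such that $\Phi(1_a)=\Phi$, and $\Phi(f\circ g)=[\Phi(f)](g)$ for all $f\in\mathrm{Hom}(b,a)$ and $g\in\mathrm{Hom}(c,b)$. *)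

(* Defs.v *)
Export EqNotations.

Set Implicit Arguments.
Unset Strict Implicit.
Unset Printing Implicit Defensive.

Record category := Category {
  obj :> Type;
  Hom : obj -> obj -> Type;
  idm : forall a, Hom a a;
  comp : forall a b c, Hom b c -> Hom a b -> Hom a c;
  comp_idl : forall a b (f : Hom a b), comp (idm b) f = f;
  comp_idr : forall a b (f : Hom a b), comp f (idm a) = f;
  compA : forall a b c d (h : Hom c d) (g : Hom b c) (f : Hom a b),
    comp h (comp g f) = comp (comp h g) f
}.

Arguments idm {c} a : rename.

Declare Scope fam_scope.
Delimit Scope fam_scope with fam.
Local Open Scope fam_scope.

Notation "g \c f" := (comp g f)
  (at level 40, left associativity) : fam_scope.

(* [is_pullback pr f q g] says that

       p ---g---> x
       |          |
       q          pr
       v          v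
       b ---f---> a

   is a pullback square. *)
Definition is_pullback (C : category) (x a b p : C)
    (pr : Hom x a) (f : Hom b a) (q : Hom p b) (g : Hom p x) : Prop :=
  pr \c g = f \c q /\
  forall (z : C) (u : Hom z x) (v : Hom z b), pr \c u = f \c v ->
    exists! h : Hom z p, g \c h = u /\ q \c h = v.

Record fam_category := FamCategory {
  fam_cat :> category;
  fHom : fam_cat -> Type;
  fcomp : forall a b : fam_cat, fHom a -> Hom b a -> fHom b;
  fcomp_id : forall (a : fam_cat) (l : fHom a), fcomp l (idm a) = l;
  fcompA : forall (a b c : fam_cat)
      (l : fHom a) (f : Hom b a) (g : Hom c b),
    fcomp l (f \c g) = fcomp (fcomp l f) g
}.

Notation "l \f f" := (fcomp l f)
  (at level 40, left associativity) : fam_scope.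

(* The strictness conditions relate arrows whose domains are Sigma-objects of
   families that are only propositionally equal, so the left-hand sides are
   transported along the laws of [fcomp]. *)
Record fam_Sigma_category := FamSigmaCategory {
  famS_fam :> fam_category;
  Sig : forall a : famS_fam, fHom a -> famS_fam;
  pr1 : forall (a : famS_fam) (l : fHom a), Hom (Sig l) a;
  Sigma : forall (a b : famS_fam) (l : fHom a) (f : Hom b a),
    Hom (Sig (l \f f)) (Sig l);
  Sigma_pullback : forall (a b : famS_fam) (l : fHom a) (f : Hom b a),
    is_pullback (pr1 l) f (pr1 (l \f f)) (Sigma l f);
  Sigma_id : forall (a : famS_fam) (l : fHom a),
    rew [fun m => Hom (Sig m) (Sig l)] fcomp_id l in Sigma l (idm a)
    = idm (Sig l);
  Sigma_comp : forall (a b c : famS_fam)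
      (l : fHom a) (f : Hom b a) (g : Hom c b),
    rew [fun m => Hom (Sig m) (Sig l)] fcompA l f g in Sigma l (f \c g)
    = Sigma l f \c Sigma (l \f f) g
}.

(* The rest of a dep-category once the fam-category and the collections of
   dependent arrows are given. *)
Record dep_category_on (C : fam_category)
    (dHom : forall a : C, fHom a -> Type) := DepCategoryOn {
  app : forall (a b : C) (l : fHom a),
    dHom a l -> forall f : Hom b a, dHom b (l \f f);
  app_id : forall (a : C) (l : fHom a) (Phi : dHom a l),
    rew [dHom a] fcomp_id l in app Phi (idm a) = Phi;
  app_comp : forall (a b c : C) (l : fHom a) (Phi : dHom a l)
      (f : Hom b a) (g : Hom c b),
    rew [dHom c] fcompA l f g in app Phi (f \c g) = app (app Phi f) g
}.

Definition dependent_object (C : fam_Sigma_category) (a : C) (l : fHom a) :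
    Type :=
  {phi : Hom a (Sig l) | pr1 l \c phi = idm a}.

(* Main.v *)
(** The application of a section [phi] of [pr1 l] to [f : Hom b a] is the base
    change of [phi] along [f]: the unique arrow into the pullback [Sig (l \f f)]
    with components [phi \c f] and [idm b]. Both laws of a dep-category follow
    from uniqueness of arrows into a pullback, since by strictness of [Sigma]
    the two sides have the same components. *)

Require Import Defs.
From Stdlib Require Import ClassicalEpsilon.

Set Implicit Arguments.
Unset Strict Implicit.
Local Open Scope fam_scope.

(** The legs of a pullback are jointly monic: [h] and [k] both mediate the cone with components
    [g \c k] and [q \c k]. *)
Lemma is_pullback_ext (C : category) (x a b p : C)
    (pr : Hom x a) (f : Hom b a) (q : Hom p b) (g : Hom p x)
    (z : C) (h k : Hom z p) :
  is_pullback pr f q g -> g \c h = g \c k -> q \c h = q \c k -> h = k.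
Proof.
intros [square universal] eq_g eq_q.
destruct (universal z (g \c k) (q \c k)) as [m [_ unique]].
- now rewrite !compA, square.
- now rewrite <- (unique h), <- (unique k).
Qed.

Lemma dependent_object_ext (C : fam_Sigma_category) (a : C) (l : fHom a)
    (phi psi : dependent_object l) :
  proj1_sig phi = proj1_sig psi -> phi = psi.
Proof.
destruct phi as [phi phi_sec], psi as [psi psi_sec]; simpl; intros <-.
now rewrite (proof_irrelevance _ phi_sec psi_sec).
Qed.

(** The laws to prove transport the section, the strictness laws transport [Sigma]; along the same
    equality the two transports cancel in the composite. *)
Lemma comp_rew_dependent_object (C : fam_Sigma_category) (a x : C)
    (l m : fHom a) (e : l = m) (s : Hom (Sig l) x) (phi : dependent_object l) :
  (rew [fun n => Hom (Sig n) x] e in s)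
    \c proj1_sig (rew [dependent_object (a := a)] e in phi)
  = s \c proj1_sig phi.
Proof. now destruct e. Qed.

Lemma base_change_exists (C : fam_Sigma_category) (a b : C) (l : fHom a)
    (phi : dependent_object l) (f : Hom b a) :
  exists psi : dependent_object (l \f f),
    Sigma l f \c proj1_sig psi = proj1_sig phi \c f.
Proof.
destruct phi as [phi phi_sec]; simpl.
destruct (Sigma_pullback l f) as [_ universal].
destruct (universal b (phi \c f) (idm b)) as [psi [[psi_Sigma psi_sec] _]].
- now rewrite compA, phi_sec, comp_idl, comp_idr.
- now exists (exist _ psi psi_sec).
Qed.

(** The pullback property yields existence only in [Prop], so the section is extracted by choice. *)
Definition base_change (C : fam_Sigma_category) (a b : C) (l : fHom a)
    (phi : dependent_object l) (f : Hom b a) : dependent_object (l \f f) :=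
  proj1_sig (constructive_indefinite_description _ (base_change_exists phi f)).

Lemma Sigma_base_change (C : fam_Sigma_category) (a b : C) (l : fHom a)
    (phi : dependent_object l) (f : Hom b a) :
  Sigma l f \c proj1_sig (base_change phi f) = proj1_sig phi \c f.
Proof.
exact (proj2_sig
  (constructive_indefinite_description _ (base_change_exists phi f))).
Qed.

Lemma base_change_id (C : fam_Sigma_category) (a : C) (l : fHom a)
    (phi : dependent_object l) :
  rew [dependent_object (a := a)] fcomp_id l in base_change phi (idm a) = phi.
Proof.
apply dependent_object_ext.
(* Inserting [idm (Sig l)] on the left gives [Sigma_id] something to rewrite into the transported
   [Sigma l (idm a)]. *)
refine (eq_trans (eq_sym (comp_idl _)) _).
now rewrite <- Sigma_id, comp_rew_dependent_object, Sigma_base_change, comp_idr.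
Qed.

Lemma base_change_comp (C : fam_Sigma_category) (a b c : C) (l : fHom a)
    (phi : dependent_object l) (f : Hom b a) (g : Hom c b) :
  rew [dependent_object (a := c)] fcompA l f g in base_change phi (f \c g)
  = base_change (base_change phi f) g.
Proof.
apply dependent_object_ext.
set (psi := rew [dependent_object (a := c)] _ in _).
assert (psi_Sigma : Sigma l f \c Sigma (l \f f) g \c proj1_sig psi
                    = proj1_sig phi \c f \c g).
{ rewrite <- Sigma_comp; unfold psi.
  now rewrite comp_rew_dependent_object, Sigma_base_change, compA. }
(* Two pasted pullbacks: first compare in the square over [g], where both sides are sections. Their
   composites with [Sigma (l \f f) g] are then compared in the square over [f]. *)
apply (is_pullback_ext (Sigma_pullback (l \f f) g)).
- rewrite Sigma_base_change.
  apply (is_pullback_ext (Sigma_pullback l f)).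
  + now rewrite !compA, psi_Sigma, Sigma_base_change.
  (* Both projections to [b] equal [g]: on the right since [base_change phi f] is a section, on the
     left by the square over [g] and since [psi] is one. *)
  + rewrite !compA, (proj2_sig (base_change phi f)), comp_idl.
    rewrite (proj1 (Sigma_pullback (l \f f) g)), <- compA.
    now rewrite (proj2_sig psi), comp_idr.
- now rewrite (proj2_sig psi), (proj2_sig (base_change (base_change phi f) g)).
Qed.

Theorem theorem4p6 (C : fam_Sigma_category) :
  inhabited (dep_category_on (@dependent_object C)).
Proof.
exact (inhabits
  (DepCategoryOn (@base_change_id C) (@base_change_comp C))).
Qed.
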